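(* Let $q$ be a prime power, let $\Delta_1,\Delta_2$ be fixed positive integers, and let $R_1,R_2$ be fixed. Let $\{C_i\}_{i=1}^{\infty}$ be a sequence of nonzero expander codes over $\mathbb{F}_q$ with parameters $\Delta_1,\Delta_2,R_1,R_2$ (as defined in the context), all of the same rate $R(C_i)=R$, and of lengths $n(C_i)=i\cdot \mathrm{LCM}(\Delta_1,\Delta_2)$. Suppose that the limit $\delta=\lim_{i\to\infty}\frac{d(C_i)}{n(C_i)}$ exists, where $d(C_i)$ is the minimum Hamming distance of $C_i$. Then $$\delta=\lim_{i\to\infty}\frac{d(C_i)}{n(C_i)}\le\frac{q-1}{q}\left(\frac{1-R}{1+R}\right).$$
   Context: The rate of a linear code $C$ of length $n$ over $\mathbb{F}_q$ is $R(C)=\dim_{\mathbb{F}_q}(C)/n$. $\mathrm{LCM}(a,b)$ is the least common multiple of $a$ and $b$. Expander codes. Let $G=(V_1:V_2,E)$ be a finite bipartite undirected connected graph (parallel edges permitted) with vertex set $V=V_1\cup V_2$, $V_1\cap V_2=\emptyset$, every edge joining $V_1$ to $V_2$, such that every $u\in V_1$ has degree $\Delta_1$ and every $v\in V_2$ has degree $\Delta_2$. Put $n=|E|$, so $|V_1|=b_1=n/\Delta_1$ and $|V_2|=b_2=n/\Delta_2$. Fix an ordering of $E$. For a vertex $u$, let $E(u)$ be the set of edges incident with $u$, and for a word $\mathbf{z}=(z_e)_{e\in E}$ let $(\mathbf{z})_{E(u)}$ be the sub-block of $\mathbf{z}$ indexed by $E(u)$. To each vertex $u_i\in V_1$ ($i=1,\dots,b_1$)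 associate a linear code $C^{(1)}_i$ over $\mathbb{F}_q$ of length $\Delta_1$ and dimension $R_1\Delta_1$, and to each vertex $v_j\in V_2$ ($j=1,\dots,b_2$) a linear code $C^{(2)}_j$ over $\mathbb{F}_q$ of length $\Delta_2$ and dimension $R_2\Delta_2$ (the codes may differ from vertex to vertex, but $R_1$ and $R_2$ are the same for all vertices of $V_1$ and of $V_2$, respectively). The corresponding expander code is $$C=\{\mathbf{c}\in\mathbb{F}_q^{|E|}:\ (\mathbf{c})_{E(u_i)}\in C^{(1)}_i\ \forall u_i\in V_1\ \text{ and }\ (\mathbf{c})_{E(v_j)}\in C^{(2)}_j\ \forall v_j\in V_2\}.$$ It is a linear code of length $n$. *)

(* Defs.v *)
From HB Require Import structures.
From mathcomp Require Import all_boot all_order all_algebra.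
From mathcomp Require Import reals.

Set Implicit Arguments.
Unset Strict Implicit.
Unset Printing Implicit Defensive.

Import GRing.Theory.
Local Open Scope ring_scope.

(* A bipartite multigraph: the ordered edge set is 'I_n and the edge e joins
   endV1 e to endV2 e, so parallel edges are allowed. *)
Record bipartite_graph (n : nat) := BipartiteGraph {
  V1 : finType;
  V2 : finType;
  endV1 : 'I_n -> V1;
  endV2 : 'I_n -> V2
}.
Arguments endV1 {n b} e : rename.
Arguments endV2 {n b} e : rename.

Section Graph.
Variables (n : nat) (G : bipartite_graph n).

Definition edges1 (u : V1 G) : {set 'I_n} := [set e | endV1 e == u].
Definition edges2 (v : V2 G) : {set 'I_n} := [set e | endV2 e == v].

Definition adjacent : rel (V1 G + V2 G) := fun x y =>
  match x, y with
  | inl u, inr v | inr v, inl u => [exists e, (endV1 e == u) && (endV2 e == v)]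
  | _, _ => false
  end.

Definition connected_graph : Prop := forall x y, connect adjacent x y.

Definition biregular (D1 D2 : nat) : Prop :=
  (forall u, #|edges1 u| = D1) /\ (forall v, #|edges2 v| = D2).
End Graph.

(* The sub-block of z indexed by A, in the order inherited from 'I_n; its
   length is cast from #|A| to D. *)
Definition subblock (F : fieldType) (n D : nat) (A : {set 'I_n})
    (hA : #|A| = D) (z : 'rV[F]_n) : 'rV[F]_D :=
  colsub (fun k : 'I_D => enum_val (cast_ord (esym hA) k)) z.

Fact subblock_is_linear (F : fieldType) (n D : nat) (A : {set 'I_n})
  (hA : #|A| = D) : linear (@subblock F n D A hA).
Proof. by move=> a x y; rewrite /subblock linearP. Qed.

HB.instance Definition _ (F : fieldType) (n D : nat) (A : {set 'I_n})
    (hA : #|A| = D) :=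
  GRing.isLinear.Build F 'rV[F]_n 'rV[F]_D _ (@subblock F n D A hA)
    (@subblock_is_linear F n D A hA).

Record expander (K : realType) (F : fieldType) (D1 D2 : nat) (R1 R2 : K)
    (n : nat) := Expander {
  graph : bipartite_graph n;
  graph_connected : connected_graph graph;
  graph_biregular : biregular graph D1 D2;
  code1 : V1 graph -> {vspace 'rV[F]_D1};
  code2 : V2 graph -> {vspace 'rV[F]_D2};
  dim_code1 : forall u, (\dim (code1 u))%:R = R1 * D1%:R;
  dim_code2 : forall v, (\dim (code2 v))%:R = R2 * D2%:R
}.

Section ExpanderCode.
Variables (K : realType) (F : fieldType) (D1 D2 : nat) (R1 R2 : K) (n : nat).
Variable X : expander F D1 D2 R1 R2 n.

Definition block1 (u : V1 (graph X)) : 'rV[F]_n -> 'rV[F]_D1 :=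
  subblock ((graph_biregular X).1 u).
Definition block2 (v : V2 (graph X)) : 'rV[F]_n -> 'rV[F]_D2 :=
  subblock ((graph_biregular X).2 v).

Definition expander_code : {vspace 'rV[F]_n} :=
  ((\bigcap_(u : V1 (graph X)) linfun (block1 u) @^-1: code1 u) :&:
   (\bigcap_(v : V2 (graph X)) linfun (block2 v) @^-1: code2 v))%VS.

Lemma mem_expander_code (c : 'rV[F]_n) :
  c \in expander_code <->
  (forall u, block1 u c \in code1 u) /\ (forall v, block2 v c \in code2 v).
Proof.
rewrite /expander_code memv_cap !memvE.
split=> [/andP[/subv_bigcapP h1 /subv_bigcapP h2] | [h1 h2]].
  split=> [u | v].
    by have := h1 u isT; rewrite -memvE -memv_preim lfunE.
  by have := h2 v isT; rewrite -memvE -memv_preim lfunE.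
apply/andP; split; apply/subv_bigcapP => w _; rewrite -memvE -memv_preim lfunE.
  exact: h1.
exact: h2.
Qed.
End ExpanderCode.

Definition code_rate (K : realType) (F : fieldType) (n : nat)
    (C : {vspace 'rV[F]_n}) : K := (\dim C)%:R / n%:R.

Definition hamming_dist (F : fieldType) (n : nat) (x y : 'rV[F]_n) : nat :=
  #|[set i | x 0 i != y 0 i]|.

(* The default n is only returned when C = 0, since Hamming distances never
   exceed n. *)
Definition min_dist (F : finFieldType) (n : nat) (C : {vspace 'rV[F]_n}) : nat :=
  \big[minn/n]_(p : 'rV[F]_n * 'rV[F]_n |
      [&& p.1 \in C, p.2 \in C & p.1 != p.2]) hamming_dist p.1 p.2.

(* Main.v *)
(* Let V be either side of the graph, with local codes of rate rho. Forcing a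
   codeword to vanish on the blocks of m vertices of V costs at most
   m rho D dimensions, so zeroing as many blocks as possible while keeping t
   dimensions leaves a code supported on about (1 - R / rho) n coordinates.
   Plotkin's bound for it, with n -> oo and then t -> oo, gives
   delta <= (q - 1) / q * (1 - R / rho). Counting parity checks gives
   R1 + R2 <= 1 + R, so the side with the smaller local rate has
   rho <= (1 + R) / 2, and then 1 - R / rho <= (1 - R) / (1 + R). *)
Require Import Defs.
From mathcomp Require Import all_boot all_order all_algebra all_field.
From mathcomp Require Import all_classical all_reals all_analysis.
From mathcomp Require Import zify ring lra.
Import Order.TTheory GRing.Theory Num.Theory.
Import numFieldNormedType.Exports.
Local Open Scope ring_scope.

(** * Dimension lost under intersections *)

(** Each intersection costs at most [e], and the running intersection stays inside [U]. So the cost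
    need only be bounded on subspaces of [U], which is all that shortening can offer. *)
Lemma dimv_bigcap_geq {F : fieldType} {vT : vectType F} (I : Type)
    (P : I -> {vspace vT}) (e : nat) (U : {vspace vT})
    (hP : forall i W, (W <= U)%VS -> (\dim W <= \dim (W :&: P i) + e)%N)
    (s : seq I) (Q : pred I) :
  (\dim U <= \dim (U :&: \bigcap_(i <- s | Q i) P i) + count Q s * e)%N.
Proof.
elim: s => [|i s IH]; first by rewrite big_nil capvf addn0.
rewrite big_cons /=; case: (Q i); last by rewrite add0n.
apply: (leq_trans IH); rewrite mulnDl mul1n addnA leq_add2r.
by rewrite [(P i :&: _)%VS]capvC capvA; apply: hP; apply: capvSl.
Qed.

(** Rank-nullity on [W] and on [W']: both contain the same part of the kernel, and the image only
    shrinks from [f @: W] to at least [f @: W :&: V], a loss of at most the codimension of [V]. *)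
Lemma dimv_cap_lpreim_geq {F : fieldType} {vT wT : vectType F}
    (f : 'Hom(vT, wT)) (V : {vspace wT}) (W : {vspace vT}) :
  (\dim W <= \dim (W :&: f @^-1: V) + (\dim {:wT} - \dim V))%N.
Proof.
set W' := (W :&: _)%VS.
have hk : (W :&: lker f <= W' :&: lker f)%VS.
  apply/subvP => x; rewrite !memv_cap => /andP[-> hx].
  by rewrite hx -memv_preim; move: hx; rewrite memv_ker => /eqP->; rewrite mem0v.
have hi : (f @: W :&: V <= f @: W')%VS.
  apply/subvP => y; rewrite memv_cap => /andP[/memv_imgP[x xW ->] fxV].
  by apply: memv_img; rewrite memv_cap xW -memv_preim.
have := dimvS hk; have := dimvS hi.
have := limg_ker_dim f W; have := limg_ker_dim f W'.
have := dimv_sum_cap (f @: W) V; have := dimvS (subvf (f @: W + V)%VS).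
have := dimvS (subvf V).
lia.
Qed.

Lemma dimv_cap_lker_geq {F : fieldType} {vT wT : vectType F}
    (f : 'Hom(vT, wT)) (W : {vspace vT}) {V : {vspace wT}} :
  (f @: W <= V)%VS -> (\dim W <= \dim (W :&: lker f) + \dim V)%N.
Proof. by move=> /dimvS fWV; rewrite -(limg_ker_dim f W) leq_add2l. Qed.

(** * Plotkin's bound *)

Definition weight {F : fieldType} {n : nat} (x : 'rV[F]_n) : nat :=
  #|[set i | x 0 i != 0]|.

Lemma min_dist_le_weight {F : finFieldType} {n : nat} (C : {vspace 'rV[F]_n})
    (x : 'rV[F]_n) : x \in C -> x != 0 -> (min_dist C <= weight x)%N.
Proof.
move=> xC x0; have -> : weight x = hamming_dist x 0.
  by apply: fintype.eq_card => i; rewrite !inE mxE.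
by apply: (@bigmin_le_cond _ nat _ _ (x, 0 : 'rV_n)); rewrite /= xC mem0v x0.
Qed.

(** The words of [W] vanishing at [i] form the kernel of a functional, of codimension at most 1,
    hence make up at least a fraction 1/q of [W]. *)
Lemma card_coord_neq0 {F : finFieldType} {n : nat} (W : {vspace 'rV[F]_n})
    (i : 'I_n) :
  (#|F| * #|[set x in W | x 0%R i != 0%R]| <= #|F|.-1 * #|F| ^ \dim W)%N.
Proof.
pose f := linfun (colsub (fun _ : 'I_1 => i) : 'rV[F]_n -> 'rV[F]_1).
have h0 : [set x in W | x 0 i == 0] = [set x in (W :&: lker f)%VS].
  apply/setP => x; rewrite !inE memv_cap memv_ker lfunE /=; congr (_ && _).
  apply/eqP/eqP => [xi|/matrixP/(_ 0 0)]; last by rewrite !mxE.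
  by apply/matrixP => a b; rewrite !mxE ord1.
have hd : (\dim W <= (\dim (W :&: lker f)).+1)%N.
  apply: leq_trans (dimv_cap_lker_geq f W (subvf _)) _.
  by rewrite dimvf addnC /dim /= mul1n.
have hs : (#|F| ^ \dim W = #|[set x in W | x 0%R i == 0%R]| +
                          #|[set x in W | x 0%R i != 0%R]|)%N.
  rewrite -card_vspace -(cardID [pred x : 'rV[F]_n | x 0 i == 0] W).
  by congr addn; apply: fintype.eq_card => x; rewrite !inE // andbC.
have : (#|F| ^ \dim W <= #|F| * #|[set x in W | x 0%R i == 0%R]|)%N.
  rewrite h0 cardsE card_vspace -expnS leq_pexp2l //.
  by apply: ltnW; apply: finRing_gt1.
have := finRing_gt1 F; rewrite -subn1 mulnBl mul1n {2}hs; nia.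
Qed.

(** Double count the pairs of a word x in [W] and a coordinate i with x_i nonzero: every nonzero
    word gives at least [d] of them, and only coordinates in [S] contribute. *)
Lemma plotkin (F : finFieldType) (n d : nat) (W : {vspace 'rV[F]_n})
    (S : {set 'I_n})
    (hS : forall x i, x \in W -> i \notin S -> x 0 i = 0)
    (hd : forall x, x \in W -> x != 0 -> (d <= weight x)%N) :
  (#|F| * (d * (#|F| ^ \dim W - 1)) <= #|F|.-1 * #|F| ^ \dim W * #|S|)%N.
Proof.
have -> : (d * (#|F| ^ \dim W - 1) = \sum_(x in W | x != 0%R) d)%N.
  rewrite sum_nat_const -card_vspace mulnC; congr (_ * _)%N.
  by rewrite (cardD1 0) mem0v addKn; apply: fintype.eq_card => x; rewrite !inE andbC.
apply: (@leq_trans (#|F| * \sum_(i in S) #|[set x in W | x 0%R i != 0%R]|)).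
  rewrite leq_mul2l; apply/orP; right.
  have -> : (\sum_(i in S) #|[set x in W | x 0%R i != 0%R]| =
             \sum_(x in W) weight x)%N.
    transitivity (\sum_(i in S) \sum_(x in W) (x 0%R i != 0%R))%N.
      apply: eq_bigr => i _; rewrite -sum1_card [RHS]big_mkcond [LHS]big_mkcond.
      by apply: eq_bigr => x _; rewrite !inE; case: (_ \in _); case: eqP.
    rewrite exchange_big /=; apply: eq_bigr => x xW.
    rewrite /weight -sum1_card [RHS]big_mkcond [LHS]big_mkcond.
    apply: eq_bigr => i _; rewrite inE; case: (boolP (i \in S)) => [_|iS].
      by case: eqP.
    by rewrite hS // eqxx.
  rewrite [leqRHS](bigID (fun x => x != 0%R)) /=.
  apply: leq_trans (leq_addr _ _).
  by apply: leq_sum => x /andP[xW x0]; apply: hd.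
rewrite big_distrr mulnC -sum_nat_const /=.
by apply: leq_sum => i _; apply: card_coord_neq0.
Qed.

(** * Blocks and edge counts *)

Lemma subblock_eq0 {F : fieldType} {n D : nat} {A : {set 'I_n}}
    (hA : #|A| = D) (x : 'rV[F]_n) (e : 'I_n) :
  e \in A -> subblock hA x = 0 -> x 0 e = 0.
Proof.
move=> eA /matrixP/(_ 0 (cast_ord hA (enum_rank_in eA e))).
by rewrite !mxE cast_ordK enum_rankK_in.
Qed.

Lemma card_preim_seq {n D : nat} {V : finType} {p : 'I_n -> V}
    (h : forall u, #|[set e | p e == u]| = D) (s : seq V) :
  uniq s -> #|[set e | p e \in s]| = (size s * D)%N.
Proof.
move=> us; rewrite -sum1dep_card (partition_big p (mem s)) //=.
rewrite -(card_uniqP us) -sum_nat_const; apply: eq_bigr => u us'.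
rewrite -(h u) -sum1dep_card; apply: eq_bigl => e.
by case: eqP => [->|]; rewrite ?us' ?andbF.
Qed.

Lemma card_biregular {n D : nat} {V : finType} {p : 'I_n -> V}
    (h : forall u, #|[set e | p e == u]| = D) : (#|V| * D)%N = n.
Proof.
rewrite cardE -(card_preim_seq h _ (enum_uniq _)) -[RHS]card_ord -cardsT.
by apply: fintype.eq_card => e; rewrite !inE mem_enum.
Qed.

(** * Shortening at the vertices of one side [V], with endpoint map [p] *)

Section Shortening.
Context {F : finFieldType} {n D r : nat} {V : finType} {p : 'I_n -> V}.
Context (h : forall u, #|[set e | p e == u]| = D).
Context (code : V -> {vspace 'rV[F]_D}) (C : {vspace 'rV[F]_n}).
Context (dim_code : forall u, \dim (code u) = r).
Context (hC : forall u c, c \in C -> subblock (h u) c \in code u).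

Let shortened (s : seq V) : {vspace 'rV[F]_n} :=
  (C :&: \bigcap_(u <- s) lker (linfun (subblock (h u))))%VS.

Let shortened_eq0 s x e : x \in shortened s -> p e \in s -> x 0 e = 0.
Proof.
rewrite memv_cap => /andP[_] /[swap] ps; rewrite (big_rem _ ps) /=.
rewrite memv_cap memv_ker lfunE /= => /andP[/eqP xe _].
by apply: subblock_eq0 xe; rewrite inE.
Qed.

(** The block at u of a word of [C] lies in [code u], so forcing it to vanish costs at most [r]
    dimensions rather than [D]. *)
Let dim_shortened s : (\dim C <= \dim (shortened s) + size s * r)%N.
Proof.
rewrite -(count_predT s); apply: dimv_bigcap_geq => u W sWC.
rewrite -(dim_code u); apply: dimv_cap_lker_geq.
apply/subvP => _ /memv_imgP[x xW ->]; rewrite lfunE.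
by apply: hC; apply: (subvP sWC).
Qed.

(** Every edge ends in [V], so zeroing all the blocks leaves only the zero word. *)
Lemma dim_block_code_leq : (\dim C <= #|V| * r)%N.
Proof.
have := dim_shortened (enum V); rewrite -cardE.
suff -> : shortened (enum V) = 0%VS by rewrite dimv0.
apply/eqP; rewrite -subv0; apply/subvP => x hx; rewrite memv0.
by apply/eqP/rowP => e; rewrite mxE (shortened_eq0 _ _ _ hx) // mem_enum.
Qed.

Lemma min_dist_block_code (K : realFieldType) (t : nat) :
  (0 < r)%N -> (t <= \dim C)%N ->
  (min_dist C)%:R * (1 - #|F|%:R ^- t) <= (#|F|%:R - 1) / #|F|%:R *
    (n%:R - D%:R * ((\dim C)%:R - t%:R) / r%:R + D%:R) :> K.
Proof.
(* The largest number of blocks whose total cost [m * r] still leaves [t] dimensions. *)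
move=> r0 tk; set m := ((\dim C - t) %/ r)%N.
have mr : (m * r <= \dim C - t)%N by apply: leq_trunc_div.
have mV : (m <= #|V|)%N.
  by rewrite -(leq_pmul2r r0); have := dim_block_code_leq; lia.
pose s := take m (enum V).
have ss : size s = m by rewrite size_takel // -cardE.
pose S := [set e | p e \notin s].
have cS : (#|S| + m * D = n)%N.
  rewrite -[RHS](card_ord n) -(cardsC S) -ss -(card_preim_seq h); last first.
    by rewrite take_uniq // enum_uniq.
  by congr (_ + _)%N; apply: fintype.eq_card => e; rewrite !inE negbK.
have tW : (t <= \dim (shortened s))%N.
  by have := dim_shortened s; rewrite ss; lia.
have PW : (#|F| * (min_dist C * (#|F| ^ \dim (shortened s) - 1)) <=
           #|F|.-1 * #|F| ^ \dim (shortened s) * #|S|)%N.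
  apply: plotkin => [x e xW|x]; last first.
    by rewrite memv_cap => /andP[xC _]; apply: min_dist_le_weight.
  by rewrite inE negbK; apply: shortened_eq0.
set w := \dim _ in PW tW.
have q1 : (1 < #|F|)%N by apply: finRing_gt1.
have qw : (0 < #|F| ^ w)%N by rewrite expn_gt0 ltnW.
move: PW; rewrite -(ler_nat K) !natrM natrB // -subn1 natrB ?(ltnW q1) // natrX.
(* Rounding down in [m] loses less than one block, which accounts for the last term [D]. *)
have hS : #|S|%:R <= n%:R - D%:R * ((\dim C)%:R - t%:R) / r%:R + D%:R :> K.
  have : (\dim C - t < m.+1 * r)%N by rewrite ltn_ceil.
  rewrite -(ltr_nat K) natrM natrB // -natr1.
  rewrite -ltr_pdivrMr ?ltr0n // => hm.
  rewrite -[X in X%:R - _]cS natrD natrM -mulrA.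
  by have := ler_wpM2l (ler0n K D) (ltW hm); lra.
set d := (min_dist C)%:R; set q := #|F|%:R.
have q1K : 1 < q by rewrite /q ltr1n.
have q0K : 0 < q by apply: lt_trans q1K.
have qw0 : 0 < q ^+ w by rewrite exprn_gt0.
move=> PW; apply: (@le_trans _ _ ((q - 1) / q * #|S|%:R)); last first.
  by rewrite ler_wpM2l // divr_ge0 ?subr_ge0 // ltW.
(* The shortened code has dimension [w] at least [t], so the defect for [w] is the smaller one. *)
apply: (@le_trans _ _ (d * (1 - q ^- w))).
  rewrite ler_wpM2l ?ler0n // lerD2l lerN2 lef_pV2 ?posrE ?exprn_gt0 //.
  by rewrite ler_eXn2l.
rewrite -(ler_pM2l (mulr_gt0 q0K qw0)).
move: PW; set c := #|S|%:R; clearbody c d q w => PW.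
suff -> : q * q ^+ w * ((q - 1) / q * c) = (q - 1) * q ^+ w * c.
  suff -> : q * q ^+ w * (d * (1 - q ^- w)) = q * (d * (q ^+ w - 1)) by [].
  by field; rewrite expf_neq0 ?gt_eqF.
by field; rewrite gt_eqF.
Qed.

End Shortening.

(** * Counting parity checks *)

(** A local code imposes [D1 - r1] or [D2 - r2] checks; start from the full space and intersect over
    one side, then over the other. *)
Lemma expander_code_dim_geq {K : realType} {F : fieldType} {D1 D2 : nat}
    {R1 R2 : K} {n r1 r2 : nat} (X : expander F D1 D2 R1 R2 n) :
  (forall u, \dim (code1 (e := X) u) = r1) ->
  (forall v, \dim (code2 (e := X) v) = r2) ->
  (n <= \dim (expander_code X) + #|V1 (graph X)| * (D1 - r1)
        + #|V2 (graph X)| * (D2 - r2))%N.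
Proof.
move=> h1 h2; have hp m (r D : nat) (f : 'Hom('rV[F]_m, 'rV[F]_D)) V W :
  \dim V = r -> (\dim W <= \dim (W :&: f @^-1: V) + (D - r))%N.
  move=> <-; apply: leq_trans (dimv_cap_lpreim_geq f V W) _.
  by rewrite dimvf /dim /= mul1n.
have b1 := dimv_bigcap_geq (V1 (graph X))
  (fun u => (linfun (block1 u) @^-1: code1 u)%VS) (D1 - r1) fullv
  (fun u W _ => hp _ _ _ (linfun (block1 u)) _ W (h1 u)) (index_enum _) xpredT.
set A := (_ :&: _)%VS in b1.
have b2 := dimv_bigcap_geq (V2 (graph X))
  (fun u => (linfun (block2 u) @^-1: code2 u)%VS) (D2 - r2) A
  (fun u W _ => hp _ _ _ (linfun (block2 u)) _ W (h2 u)) (index_enum _) xpredT.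
have fX : (A :&: \bigcap_v linfun (block2 (X := X) v) @^-1: code2 v)%VS = expander_code X.
  by rewrite /A capfv.
rewrite !count_predT /= in b1 b2; rewrite fX in b2.
rewrite dimvf /dim /= mul1n in b1.
have eV (T : finType) : size (index_enum T) = #|T|.
  by rewrite cardE enumT.
by rewrite !eV in b1 b2; apply: leq_trans b1 _; rewrite addnAC leq_add2r.
Qed.

(** * Passage to the limit *)

Local Open Scope classical_set_scope.
Local Open Scope ring_scope.

(** If y < x, the hypothesis keeps (x - y) q^t at most x for all t, against the growth given by
    Bernoulli's inequality [hq]. *)
Lemma le_of_exp_defect {K : archiRealFieldType} (q x y : K) : 1 < q ->
  (forall t : nat, x * (1 - q ^- t) <= y) -> x <= y.
Proof.
move=> q1 hxy; rewrite leNgt; apply/negP => yx.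
have q0 : 0 < q by lra.
have hq t : 1 + t%:R * (q - 1) <= q ^+ t.
  elim: t => [|t IH]; first by rewrite mul0r addr0 expr0.
  rewrite exprS; have := ler_wpM2l (ltW q0) IH.
  have : 0 <= t%:R * (q - 1) ^+ 2 by rewrite mulr_ge0 ?sqr_ge0.
  by rewrite -natr1; lra.
have y0 : 0 <= y by have := hxy 0; rewrite expr0 invr1 subrr mulr0.
have ht t : (x - y) * q ^+ t <= x.
  have qt : 0 < q ^+ t by rewrite exprn_gt0.
  have := hxy t; rewrite -(ler_pM2r qt) -mulrA mulrBl mul1r mulVf ?gt_eqF //.
  lra.
(* Beyond this exponent Bernoulli's lower bound for (x - y) q^t exceeds x. *)
pose z := x / ((x - y) * (q - 1)).
have z0 : 0 <= z by rewrite divr_ge0 ?mulr_ge0; lra.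
have := archi_boundP z0; set N := Num.bound _.
rewrite ltr_pdivrMr; last by rewrite mulr_gt0; lra.
have := ht N; have := hq N.
have : 0 < x - y by lra.
nra.
Qed.

(** For fixed [t], dividing by the length makes the terms in [t] and the extra [D] vanish in the
    limit; only then does [t] grow. *)
Lemma asymptotic_shortening_bound {K : realType} (q c R delta : K)
    (L D r : nat) (k d : nat -> nat) :
  1 < q -> (0 < L)%N -> 0 < R ->
  (forall i, (k i)%:R = R * (i.+1 * L)%:R) ->
  (forall t i, (t <= k i)%N -> (d i)%:R * (1 - q ^- t) <=
    c * ((i.+1 * L)%:R - D%:R * ((k i)%:R - t%:R) / r%:R + D%:R)) ->
  (fun i => (d i)%:R / (i.+1 * L)%:R : K) @ \oo --> delta ->
  delta <= c * (1 - R * (D%:R / r%:R)).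
Proof.
move=> q1 L0 R0 hk hd hdelta; apply: (@le_of_exp_defect _ q) => // t.
have L0K : (0 : K) < L%:R by rewrite ltr0n.
(* The right side of the bound divided by the length, with [k i] replaced by R times the length. *)
pose g (i : nat) : K := c * (1 - R * (D%:R / r%:R)) +
  c * (D%:R * t%:R / r%:R + D%:R) / L%:R * @harmonic K i.
have cg : g @ \oo --> c * (1 - R * (D%:R / r%:R)).
  rewrite -[X in _ --> X]addr0; apply: cvgD; first exact: cvg_cst.
  rewrite -[X in _ --> X](mulr0 (c * (D%:R * t%:R / r%:R + D%:R) / L%:R)).
  by apply: cvgM; [exact: cvg_cst | exact: cvg_harmonic].
apply: (ler_cvg_to (cvgM hdelta (cvg_cst (1 - q ^- t))) cg).
(* From here on the length exceeds t / R, so the dimension [k i] is at least [t]. *)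
exists (Num.bound (t%:R / R)) => // i /= hi.
have n0 : (0 : K) < (i.+1 * L)%:R by rewrite ltr0n muln_gt0.
have tk : (t <= k i)%N.
  rewrite -(ler_nat K) hk.
  have : t%:R / R <= (i.+1 * L)%:R.
    apply: le_trans (ltW (archi_boundP _)) _; first by rewrite divr_ge0 // ltW.
    by rewrite ler_nat; nia.
  by rewrite ler_pdivrMr // mulrC.
have := hd t i tk; rewrite hk.
rewrite -(ler_pM2r (_ : 0 < (i.+1 * L)%:R^-1)) ?invr_gt0 // => H.
apply: le_trans (_ : _ <= _); last first.
  apply: le_trans H _.
  rewrite le_eqVlt; apply/orP; left; apply/eqP; rewrite /g /harmonic natrM /=.
  have N0 : (i.+1%:R : K) != 0 by rewrite pnatr_eq0.
  move: (gt_eqF L0K) N0; set N := i.+1%:R; set l := L%:R; set u := r%:R^-1.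
  clearbody N l u => /negbT l0 N0. by field; rewrite N0 l0.
by rewrite mulrAC.
Qed.

(** * The bound for expander codes *)

Theorem theorem2 (K : realType) (q : nat) (F : finFieldType) (hq : #|F| = q)
  (D1 D2 : nat) (hD1 : (0 < D1)%N) (hD2 : (0 < D2)%N) (R1 R2 R : K)
  (* C i is the (i+1)-st member of the sequence, of length (i+1) lcm(D1, D2) *)
  (C : forall i : nat, expander F D1 D2 R1 R2 (i.+1 * lcmn D1 D2))
  (hC : forall i, expander_code (C i) <> 0%VS)
  (hR : forall i, code_rate K (expander_code (C i)) = R)
  (delta : K)
  (hdelta : (fun i : nat => (min_dist (expander_code (C i)))%:R
                            / (i.+1 * lcmn D1 D2)%:R : K) @ \oo --> delta) :
  delta <= (q%:R - 1) / q%:R * ((1 - R) / (1 + R)).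
Proof.
have L0 : (0 < lcmn D1 D2)%N by rewrite lcmn_gt0 hD1.
have q1 : 1 < q%:R :> K by rewrite -hq ltr1n finRing_gt1.
have n0 i : (0 : K) < (i.+1 * lcmn D1 D2)%:R by rewrite ltr0n muln_gt0.
have k0 i : (0 < \dim (expander_code (C i)))%N.
  by rewrite lt0n dimv_eq0; apply/eqP/hC.
have hk i : (\dim (expander_code (C i)))%:R = R * (i.+1 * lcmn D1 D2)%:R.
  by rewrite -(hR i) /code_rate divfK // gt_eqF.
have R0 : 0 < R by rewrite -(hR 0%N) divr_gt0 // ltr0n.
(* An edge of the first graph supplies a vertex on each side where the local dimension can be read
   off; the fixed rates make it the same at all vertices of that side, in every graph. *)
have e0 : 'I_(1 * lcmn D1 D2) by exists 0%N; rewrite mul1n.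
pose r1 := \dim (code1 (endV1 (b := graph (C 0%N)) e0)).
pose r2 := \dim (code2 (endV2 (b := graph (C 0%N)) e0)).
have h1 i u : \dim (code1 (e := C i) u) = r1.
  by apply/eqP; rewrite -(eqr_nat K) !dim_code1.
have h2 i v : \dim (code2 (e := C i) v) = r2.
  by apply/eqP; rewrite -(eqr_nat K) !dim_code2.
have c1 i u c : c \in expander_code (C i) ->
    subblock ((graph_biregular (C i)).1 u) c \in code1 u.
  by move=> /mem_expander_code[+ _]; apply.
have c2 i v c : c \in expander_code (C i) ->
    subblock ((graph_biregular (C i)).2 v) c \in code2 v.
  by move=> /mem_expander_code[_]; apply.
have b1 i := card_biregular (graph_biregular (C i)).1.
have b2 i := card_biregular (graph_biregular (C i)).2.
have m1 := dim_block_code_leq _ _ _ (h1 0%N) (c1 0%N).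
have m2 := dim_block_code_leq _ _ _ (h2 0%N) (c2 0%N).
have r10 : (0 < r1)%N.
  by have := leq_trans (k0 0%N) m1; rewrite muln_gt0 => /andP[].
have r20 : (0 < r2)%N.
  by have := leq_trans (k0 0%N) m2; rewrite muln_gt0 => /andP[].
have r1D : (r1 <= D1)%N.
  rewrite -(h1 0%N (endV1 e0)) (leq_trans (dimvS (subvf _))) //.
  by rewrite dimvf /dim /= mul1n.
have r2D : (r2 <= D2)%N.
  rewrite -(h2 0%N (endV2 e0)) (leq_trans (dimvS (subvf _))) //.
  by rewrite dimvf /dim /= mul1n.
have D10 : (0 : K) < D1%:R by rewrite ltr0n.
have D20 : (0 : K) < D2%:R by rewrite ltr0n.
have rates : r1%:R / D1%:R + r2%:R / D2%:R <= 1 + R.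
  have := expander_code_dim_geq _ (h1 0%N) (h2 0%N).
  have := hk 0%N; have := b1 0%N; have := b2 0%N; have := n0 0%N.
  (* The order of the premises makes [B1] the size of the second side and [B2] that of the first. *)
  set n := (1 * _)%N; set B1 := #|_|; set B2 := #|_|; set k := \dim _.
  clearbody n B1 B2 k => n0'.
  move=> /(congr1 (fun x => x%:R : K)) + /(congr1 (fun x => x%:R : K)).
  rewrite -(ler_nat K) !(natrD, natrM) !natrB // => e2 e1 -> hn.
  have E1 : r1%:R / D1%:R * n%:R = B2%:R * r1%:R :> K.
    by rewrite -e1 mulrCA divfK ?gt_eqF.
  have E2 : r2%:R / D2%:R * n%:R = B1%:R * r2%:R :> K.
    by rewrite -e2 mulrCA divfK ?gt_eqF.
  by rewrite -(ler_pM2r n0') mulrDl E1 E2; lra.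
have half (D r : nat) : (0 < D)%N -> (0 < r)%N -> 2 * (r%:R / D%:R) <= 1 + R ->
    delta <= (q%:R - 1) / q%:R * (1 - R * (D%:R / r%:R)) ->
    delta <= (q%:R - 1) / q%:R * ((1 - R) / (1 + R)).
  move=> D0 r0 hr /le_trans; apply.
  rewrite ler_wpM2l ?divr_ge0 ?subr_ge0 ?(ltW q1) //.
  have rD : (0 : K) < r%:R / D%:R by rewrite divr_gt0 ?ltr0n.
  rewrite -[D%:R / _]invf_div; set x := _ / _ in hr rD *.
  rewrite ler_pdivlMr; last by lra.
  have xV : x * x^-1 = 1 by rewrite divff ?gt_eqF.
  have xV0 : 0 < x^-1 by rewrite invr_gt0.
  (* Expanded, this is exactly (1 - R / x) (1 + R) <= 1 - R. *)
  have : 0 <= R * x^-1 * (1 + R - 2 * x).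
    by apply: mulr_ge0; [apply: mulr_ge0; lra | lra].
  clearbody x; set y := x^-1 in xV xV0 *; clearbody y; nra.
pose k i := \dim (expander_code (C i)).
pose d i := min_dist (expander_code (C i)).
(* The smaller local rate is at most the average of the two, hence at most (1 + R) / 2. *)
have [hle|hle] := leP (r1%:R / D1%:R : K) (r2%:R / D2%:R).
  apply: (half D1 r1) => //; first by lra.
  apply: (asymptotic_shortening_bound _ _ _ _ _ D1 r1 k d q1 L0 R0 hk _ hdelta).
  by move=> t i tk; rewrite -hq;
  exact: (min_dist_block_code _ _ _ (h1 i) (c1 i)).
apply: (half D2 r2) => //; first by lra.
apply: (asymptotic_shortening_bound _ _ _ _ _ D2 r2 k d q1 L0 R0 hk _ hdelta).
by move=> t i tk; rewrite -hq;
  exact: (min_dist_block_code _ _ _ (h2 i) (c2 i)).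
Qed.
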